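(* Let $b>0$ be a real number and let $k\ge 1$ be an integer with $b>k$. If $\beta=1$, $m=1$, $a=1$ and $c=1$, then the factorial moment of order $k$ of $\mathcal{GNB\text{-}BE}(m,\beta,a,b,c)$ reduces to the factorial moment of order $k$ of the Yule distribution, which is $$\mu_{[k]}=\frac{(k!)^2}{(b-1)(b-2)\cdots(b-k)}.$$
   Context: For $r,s>0$, $B(r,s)=\frac{\Gamma(r)\Gamma(s)}{\Gamma(r+s)}$. For $u>0$ and integer $s\ge 0$, $u_{(s)}=\frac{\Gamma(u+s)}{\Gamma(u)}$. For real $y$ and integer $x\ge 0$, $\binom{y}{x}=\frac{y(y-1)\cdots(y-x+1)}{x!}$. The generalized negative binomial distribution $\mathcal{GNB}(m,\beta,\theta)$ has probability mass function $\frac{m}{m+\beta x}\binom{m+\beta x}{x}(1-\theta)^{x}\theta^{m+\beta x-x}$, $x=0,1,2,\dots$. The beta exponential distribution $\mathcal{BE}(a,b,c)$, $a,b,c>0$, has density $g(\lambda;a,b,c)=\frac{c}{B(a,b)}e^{-bc\lambda}(1-e^{-c\lambda})^{a-1}$ for $\lambda>0$. The distribution $\mathcal{GNB\text{-}BE}(m,\beta,a,b,c)$ is the mixture defined by $X\mid\lambda\sim\mathcal{GNB}(m,\beta,\theta=e^{-\lambda})$, $\lambda\sim\mathcal{BE}(a,b,c)$: its mass function is $$p(x)=\int_0^\infty \frac{m}{m+\beta x}\binom{m+\beta x}{x}(1-e^{-\lambda})^{x}e^{-\lambda(m+\beta x-x)}\,g(\lambda;a,b,c)\,d\lambda,\qquad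 x=0,1,2,\dots$$ The Yule distribution with parameter $b>0$ has mass function $\frac{b\,x!}{(b+1)_{(x+1)}}$, $x=0,1,2,\dots$. The factorial moment of order $k$ is $\mu_{[k]}=E[X(X-1)\cdots(X-k+1)]$. *)

(* Defs.v *)
From HB Require Import structures.
From mathcomp Require Import all_boot all_order all_algebra.
From mathcomp Require Import all_classical all_reals all_analysis.

Set Implicit Arguments.
Unset Strict Implicit.
Unset Printing Implicit Defensive.

Import Order.TTheory GRing.Theory Num.Theory.
Import numFieldNormedType.Exports.

Local Open Scope classical_set_scope.
Local Open Scope ring_scope.

Section special_functions.
Context {R : realType}.
Implicit Types (r s u y : R) (n x : nat).

Definition Gamma r : R :=
  \int[@lebesgue_measure R]_(t in `]0, +oo[) (t `^ (r - 1) * expR (- t)).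

Definition Beta r s : R := Gamma r * Gamma s / Gamma (r + s).

Definition pochhammer u n : R := Gamma (u + n%:R) / Gamma u.

Definition gbinom y x : R := (\prod_(i < x) (y - i%:R)) / x`!%:R.

End special_functions.

Section mass_functions.
Context {R : realType}.
Implicit Types (m beta theta a b c l : R) (x : nat).

Definition gnb_pmf m beta theta x : R :=
  m / (m + beta * x%:R) * gbinom (m + beta * x%:R) x *
  (1 - theta) ^+ x * theta `^ (m + beta * x%:R - x%:R).

(* The formula of the density on the support l > 0; it is only ever integrated
   over ]0, +oo[. *)
Definition be_pdf a b c l : R :=
  c / Beta a b * expR (- (b * c * l)) * (1 - expR (- (c * l))) `^ (a - 1).

Definition gnbbe_pmf m beta a b c x : R :=
  \int[@lebesgue_measure R]_(l in `]0, +oo[)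
    (gnb_pmf m beta (expR (- l)) x * be_pdf a b c l).

Definition yule_pmf b x : R := b * x`!%:R / pochhammer (b + 1) x.+1.

End mass_functions.

Definition is_pmf {R : realType} (p : nat -> R) : Prop :=
  (forall x, 0 <= p x) /\ (\sum_(0 <= x <oo) (p x)%:E = 1)%E.

(* The law on nat with mass function p. As for the discrete distributions of
   the library, the Dirac mass at 0 is a junk value making this a probability
   measure also when p is not a mass function. *)
Definition discrete_prob {R : realType} (p : nat -> R) : set nat -> \bar R :=
  fun A => if `[< is_pmf p >] then \esum_(x in A) (p x)%:E else \d_0%N A.

Section discrete_prob.
Context {R : realType} (p : nat -> R).
Local Open Scope ereal_scope.

Local Notation law := (discrete_prob p).

Let law0 : law set0 = 0.
Proof.
by rewrite /discrete_prob measure0; case: ifPn => //; rewrite esum_set0.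
Qed.

Let law_ge0 A : 0 <= law A.
Proof.
rewrite /discrete_prob; case: ifPn => // /asboolP[p0 _].
by apply: esum_ge0 => x _; rewrite lee_fin p0.
Qed.

Let law_sigma_additive : semi_sigma_additive law.
Proof.
move=> F mF tF mUF; rewrite /discrete_prob; case: ifPn => [/asboolP[p0 _]|_].
  apply: cvg_toP.
    apply: ereal_nondecreasing_is_cvgn => i j ij.
    apply: lee_sum_nneg_natr => // n _ _.
    by apply: esum_ge0 => /= x _; rewrite lee_fin p0.
  by rewrite nneseries_sum_bigcup// => i; rewrite lee_fin p0.
exact: measure_semi_sigma_additive.
Qed.

HB.instance Definition _ := isMeasure.Build _ _ _ law
  law0 law_ge0 law_sigma_additive.

Let law_setT : law [set: nat] = 1.
Proof.
rewrite /discrete_prob; case: ifPn => [/asboolP[p0 p1]|_].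
  by rewrite -nneseries_esumT// => x _; rewrite lee_fin p0.
by rewrite probability_setT.
Qed.

HB.instance Definition _ :=
  @Measure_isProbability.Build _ _ R law law_setT.

End discrete_prob.

Section distributions.
Context {R : realType}.

Definition GNB_BE (m beta a b c : R) : probability nat R :=
  discrete_prob (gnbbe_pmf m beta a b c).

Definition Yule (b : R) : probability nat R := discrete_prob (yule_pmf b).

(* x ^_ k = x (x - 1) ... (x - k + 1) *)
Definition factorial_moment (P : probability nat R) (k : nat) : \bar R :=
  'E_P[fun x : nat => (x ^_ k)%:R].

End distributions.

(* Main.v *)
Require Import Defs.
From mathcomp Require Import all_boot all_order all_algebra.
From mathcomp Require Import all_classical all_reals all_analysis.
From mathcomp Require Import measurable_realfun.
From mathcomp Require Import ring lra zify.
Import Order.TTheory GRing.Theory Num.Theory.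
Import numFieldNormedType.Exports.
Local Open Scope classical_set_scope.
Local Open Scope ring_scope.

(** With m = beta = 1 the conditional law of X given lambda is geometric,
    with mass function (1 - e^-lambda)^x e^-lambda, and with a = c = 1 the
    mixing law is exponential of rate b. Mixing therefore gives
    b * int_0^oo (1 - e^-t)^x e^-((b+1)t) dt, which is
    b x! / ((b+1) ... (b+x+1)), the Yule mass function: the two laws have the
    same mass function (gnbbe_pmf_yule), hence the same factorial moments.
    The integral is computed through a first-difference recurrence in x
    (pow_exp_integral). The Gamma quotients that define Beta 1 b and the rising
    factorial are evaluated by the functional equation and the positivity of
    Gamma (GammaS, Gamma_gt0); as b > k >= 1, all their arguments but one are
    greater than 1, the exception being Gamma 1 = 1.

    For the moments of the Yule law p, let T_n = n! / ((b+1) ... (b+n)). Then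
    p_n = T_n - T_(n+1) and T_(n+1) = (n+1) p_n / b, so summation by parts
    relates the truncated moments S_k(n) = sum_(x < n) x^_k p_x of consecutive
    orders:
      (b - k) S_k(n) = k^2 S_(k-1)(n) - b n^_k T_n      (k >= 1),
    while S_0(n) = 1 - T_n (yule_partial_momentS, yule_partial_moment0). The
    boundary term n^_k T_n tends to 0 as soon as k < b: it is at most
    k! / (1 + c H_n) with c > 0 and H_n the n-th partial sum of the harmonic
    series (cvg_ffact_yule_tail). In the limit, mu_k = k^2 mu_(k-1) / (b - k) with
    mu_0 = 1, which is the announced product. *)

(** * Integration of exponentially dominated functions on the half-line *)

Section half_line.
Context {R : realType}.
Implicit Types (f F : R -> R) (C c d l t : R).
Local Notation mu := (@lebesgue_measure R).
Local Notation half := `](0 : R), +oo[%classic.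

Lemma is_derive_expRN c t :
  is_derive t 1 (fun t => expR (- (c * t))) (- c * expR (- (c * t))).
Proof.
have H : is_derive t 1 (fun t => - (c * t)) (- c).
  by apply: is_derive_eq; rewrite -[_ *: _]/(_ * _) mulr1.
have := is_derive1_comp (is_derive_expR _) H.
by move/is_derive_eq; apply; rewrite mulrC.
Qed.

Lemma continuous_expRN c : continuous (fun t => expR (- (c * t))).
Proof.
move=> t; apply/differentiable_continuous/derivable1_diffP.
by have [] := is_derive_expRN c t.
Qed.

Lemma cvg_expRN c : 0 < c -> expR (- (c * t)) @[t --> +oo] --> 0.
Proof.
move=> c0; apply: (@cvg_comp _ _ _ (fun t => c * t) (fun t => expR (- t)) _
  (pinfty_nbhs R)).
  exact: gt0_cvgMry.
exact: cvgr_expR.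
Qed.

Lemma ge0_FTC_half f F l :
  (forall t, 0 <= t -> 0 <= f t) ->
  (forall t, 0 < t -> {for t, continuous f}) -> f t @[t --> 0^'+] --> f 0 ->
  F t @[t --> +oo] --> l -> F t @[t --> 0^'+] --> F 0 ->
  (forall t, 0 < t -> is_derive t 1 F (f t)) ->
  mu.-integrable half (EFin \o f) /\ \int[mu]_(t in half) f t = l - F 0.
Proof.
move=> f0 cf cf0 Fl F0 dF.
have cfw : {within `[0, +oo[, continuous f}.
  apply/continuous_within_itvcyP; split => // t.
  by rewrite in_itv/= andbT; exact: cf.
have mf : measurable_fun half f.
  apply: open_continuous_measurable_fun => // t /set_mem/=.
  by rewrite in_itv/= andbT; exact: cf.
have If : (\int[mu]_(t in half) (f t)%:E = l%:E - (F 0)%:E)%E.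
  rewrite integral_itv_obnd_cbnd; last exact/measurable_EFinP.
  apply: ge0_continuous_FTC2y => //.
    by move=> t /dF[].
  move=> t; rewrite in_itv/= andbT => /dF dFt.
  by rewrite derive1E derive_val.
split; last by rewrite /Rintegral If.
apply/integrableP; split; first exact/measurable_EFinP.
apply: le_lt_trans (ltry (l - F 0)); rewrite EFinB -If.
apply: ge0_le_integral => //.
- by apply: measurableT_comp => //; exact/measurable_EFinP.
- exact/measurable_EFinP.
- by move=> t /=; rewrite in_itv/= andbT => /ltW/f0 ft; rewrite ger0_norm.
Qed.

Lemma exp_integral c : 0 < c ->
  mu.-integrable half (EFin \o (fun t => expR (- (c * t)))) /\
  \int[mu]_(t in half) expR (- (c * t)) = c^-1.
Proof.
move=> c0.
have cE := continuous_expRN c.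
have -> : c^-1 = 0 - - c^-1 * expR (- (c * 0)).
  by rewrite mulr0 oppr0 expR0 mulr1 sub0r opprK.
apply: (ge0_FTC_half (fun t => expR (- (c * t)))
  (fun t => - c^-1 * expR (- (c * t)))).
- by move=> t _; exact: expR_ge0.
- by move=> t _; exact: cE.
- by apply: cvg_at_right_filter; exact: cE.
- by rewrite -(mulr0 (- c^-1)); apply: cvgMl_tmp; exact: cvg_expRN.
- by apply: cvgMl_tmp; apply: cvg_at_right_filter; exact: cE.
- move=> t t0; have ? := is_derive_expRN c t.
  apply: is_derive_eq; rewrite -[_ *: _]/(_ * _).
  by field; exact: lt0r_neq0.
Qed.

Lemma dominated_integrable f C c : 0 < c -> measurable_fun half f ->
  (forall t, 0 < t -> `|f t| <= C * expR (- (c * t))) ->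
  mu.-integrable half (EFin \o f).
Proof.
move=> c0 mf fC; have [iE _] := exp_integral c c0.
have iCE : mu.-integrable half (EFin \o (fun t => C * expR (- (c * t)))).
  exact: (integrableZl _ C iE).
apply: le_integrable iCE => //; first exact/measurable_EFinP.
move=> t; rewrite /= in_itv/= andbT => t0.
by rewrite lee_fin (le_trans (fC _ t0))// ler_norm.
Qed.

(** Domination by C e^-ct allows integrands of any sign: f + C e^-ct is
    nonnegative with a known primitive, and the exponential is subtracted
    afterwards. *)
Lemma dominated_FTC_half f F l C c : 0 < c ->
  (forall t, 0 <= t -> `|f t| <= C * expR (- (c * t))) ->
  (forall t, 0 < t -> {for t, continuous f}) -> f t @[t --> 0^'+] --> f 0 ->
  F t @[t --> +oo] --> l -> F t @[t --> 0^'+] --> F 0 ->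
  (forall t, 0 < t -> is_derive t 1 F (f t)) ->
  \int[mu]_(t in half) f t = l - F 0.
Proof.
move=> c0 fC cf cf0 Fl F0 dF.
have cE := continuous_expRN c.
have mf : measurable_fun half f.
  apply: open_continuous_measurable_fun => // t /set_mem/=.
  by rewrite in_itv/= andbT; exact: cf.
have fi : mu.-integrable half (EFin \o f).
  by apply: (dominated_integrable f C c) => // t /ltW; exact: fC.
have [gi gI] := exp_integral c c0.
have Cgi : mu.-integrable half (EFin \o (fun t => C * expR (- (c * t)))).
  exact: (integrableZl _ C gi).
have [] := ge0_FTC_half (fun t => f t + C * expR (- (c * t)))
  (fun t => F t + - (C / c) * expR (- (c * t))) (l + - (C / c) * 0).
- by move=> t /fC; rewrite ler_norml -lerBlDr sub0r => /andP[].
- move=> t t0; apply: cvgD; first exact: cf.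
  by apply: cvgMl_tmp; exact: cE.
- by apply: cvgD => //; apply: cvgMl_tmp; apply: cvg_at_right_filter; exact: cE.
- by apply: cvgD => //; apply: cvgMl_tmp; exact: cvg_expRN.
- by apply: cvgD => //; apply: cvgMl_tmp; apply: cvg_at_right_filter; exact: cE.
- move=> t t0; have ? := is_derive_expRN c t; have ? := dF t t0.
  apply: is_derive_eq; rewrite -[_ *: _]/(_ * _).
  by field; exact: lt0r_neq0.
- move=> _; rewrite RintegralD// RintegralZl// gI.
  rewrite mulr0 addr0 [c * 0]mulr0 oppr0 expR0 mulr1 => /(canRL (addrK _)) ->.
  by ring.
Qed.

End half_line.

(** * The Gamma function on ]1, +oo[ *)

Section gamma.
Context {R : realType}.
Implicit Types (r s t u b : R).
Local Notation mu := (@lebesgue_measure R).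
Local Notation half := `](0 : R), +oo[%classic.

Lemma continuous_expN : continuous (fun t => expR (- t)).
Proof.
by have := continuous_expRN (1 : R); under eq_fun do rewrite mul1r.
Qed.

Definition gamma_integrand s t : R := t `^ s * expR (- t).

Lemma gamma_integrand_ge0 s t : 0 <= gamma_integrand s t.
Proof. by rewrite mulr_ge0 ?powR_ge0 ?expR_ge0. Qed.

(** The bound t <= m e^(t/m), raised to the power s, costs a factor e^(st/m);
    m = 2 (s + 1) keeps it below e^(t/2), half of the available decay. *)
Lemma gamma_integrand_le s : 0 <= s -> exists C, forall t, 0 <= t ->
  gamma_integrand s t <= C * expR (- (2^-1 * t)).
Proof.
move=> s0; set m := 2 * (s + 1); have m0 : 0 < m by rewrite /m; lra.
exists (m `^ s) => t t0.
have tm : t <= m * expR (t / m).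
  rewrite -ler_pdivrMl// mulrC (le_trans _ (expR_ge1Dx _))//; lra.
have -> : - (2^-1 * t) = 2^-1 * t + - t by field.
rewrite expRD mulrA ler_wpM2r ?expR_ge0//.
apply: (@le_trans _ _ ((m * expR (t / m)) `^ s)).
  by rewrite ge0_ler_powR// nnegrE mulr_ge0 ?expR_ge0// ltW.
rewrite powRM ?expR_ge0 ?(ltW m0)// -expRM ler_wpM2l ?powR_ge0// ler_expR.
rewrite mulrAC ler_pdivrMr// /m; nra.
Qed.

Lemma gamma_integrand_continuous s t : 0 < t ->
  {for t, continuous (gamma_integrand s)}.
Proof.
move=> t0; have cp : {for t, continuous (@powR R ^~ s)}.
  apply/differentiable_continuous/derivable1_diffP.
  by have [] := is_derive1_powR s t0.
apply: cvgM; first exact: cp.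
exact: continuous_expN.
Qed.

Lemma cvg_at_right0_gamma_integrand s : 0 < s ->
  gamma_integrand s t @[t --> 0^'+] --> gamma_integrand s 0.
Proof.
move=> s0; apply: cvgM; first by rewrite powR0 ?gt_eqF//; exact: powR_cvg0.
by apply: cvg_at_right_filter; exact: continuous_expN.
Qed.

Lemma gamma_integrand_cvg0 s : 0 <= s -> gamma_integrand s t @[t --> +oo] --> 0.
Proof.
move=> s0; have [C sC] := gamma_integrand_le s s0.
apply: (@squeeze_cvgr _ _ _ _ (cst 0) (fun t => C * expR (- (2^-1 * t)))).
- near=> t; rewrite gamma_integrand_ge0 sC//.
- exact: cvg_cst.
- by rewrite -(mulr0 C); apply: cvgMl_tmp; apply: cvg_expRN; lra.
Unshelve. all: by end_near. Qed.

Lemma gamma_integrable s : 0 <= s ->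
  mu.-integrable half (EFin \o gamma_integrand s).
Proof.
move=> s0; have [C sC] := gamma_integrand_le s s0.
apply: (dominated_integrable _ C 2^-1); first by lra.
  apply: open_continuous_measurable_fun => // t /set_mem/=.
  by rewrite in_itv/= andbT; exact: gamma_integrand_continuous.
by move=> t /ltW/sC; rewrite ger0_norm// gamma_integrand_ge0.
Qed.

Lemma Gamma1 : Gamma (1 : R) = 1.
Proof.
rewrite /Gamma subrr; have [_] := exp_integral (1 : R) ltr01.
rewrite invr1 => <-; apply: eq_Rintegral => t _.
by rewrite powRr0 !mul1r.
Qed.

(** The function t^r e^-t vanishes at both ends and has derivative
    r t^(r-1) e^-t - t^r e^-t, whose integral is therefore zero. The condition
    1 < r makes this derivative continuous at 0. *)
Lemma GammaS r : 1 < r -> Gamma (r + 1) = r * Gamma r.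
Proof.
move=> r1; rewrite /Gamma addrK.
have r10 : 0 < r - 1 by lra.
have r0 : 0 < r by lra.
have i1 := gamma_integrable r (ltW r0).
have i2 := gamma_integrable (r - 1) (ltW r10).
have ri2 : mu.-integrable half
    (EFin \o (fun t => r * gamma_integrand (r - 1) t)).
  exact: (integrableZl _ r i2).
apply/eqP; rewrite -subr_eq0 -RintegralZl// -RintegralB//.
have [C1 C1E] := gamma_integrand_le r (ltW r0).
have [C2 C2E] := gamma_integrand_le (r - 1) (ltW r10).
have gE0 : 0 = - 0 - - gamma_integrand r 0.
  by rewrite /gamma_integrand powR0 ?gt_eqF// mul0r subrr.
apply/eqP; rewrite [RHS]gE0.
apply: (dominated_FTC_half _ (fun t => - gamma_integrand r t) (- 0)
  (C1 + r * C2) 2^-1).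
- lra.
- move=> t t0; rewrite (le_trans (ler_normB _ _))// mulrDl lerD//.
    by rewrite ger0_norm ?gamma_integrand_ge0// C1E.
  rewrite normrM (ger0_norm (ltW r0)) ger0_norm ?gamma_integrand_ge0//.
  by rewrite -mulrA ler_pM2l// C2E.
- move=> t t0; apply: cvgB; first exact: gamma_integrand_continuous.
  by apply: cvgMl_tmp; exact: gamma_integrand_continuous.
- apply: cvgB; first exact: cvg_at_right0_gamma_integrand.
  by apply: cvgMl_tmp; exact: cvg_at_right0_gamma_integrand.
- by apply: cvgN; apply: gamma_integrand_cvg0; exact: ltW.
- by apply: cvgN; exact: cvg_at_right0_gamma_integrand.
- move=> t t0; rewrite /gamma_integrand.
  have ? := is_derive1_powR r t0.
  have := is_derive_expRN 1 t; under eq_fun do rewrite mul1r; rewrite !mul1r => ?.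
  apply: is_derive_eq; rewrite -![_ *: _]/(_ * _); ring.
Qed.

(** On [1, 2] the integrand is at least e^-2. *)
Lemma Gamma_gt0 r : 1 <= r -> 0 < Gamma r.
Proof.
move=> r1; have r10 : 0 <= r - 1 by lra.
have gi := gamma_integrable (r - 1) r10.
rewrite -lte_fin /Gamma fineK; last exact: integrable_fin_num gi.
have mg : measurable_fun half (EFin \o gamma_integrand (r - 1)).
  exact: measurable_int gi.
have sub12 : `[1, 2] `<=` half.
  by move=> t /=; rewrite !in_itv/= andbT => /andP[+ _]; exact: lt_le_trans.
have int12 : (\int[mu]_(t in `[1%R, 2%R]) (gamma_integrand (r - 1) t)%:E <=
    \int[mu]_(t in half) (gamma_integrand (r - 1) t)%:E)%E.
  apply: ge0_subset_integral => // t _.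
  by rewrite lee_fin gamma_integrand_ge0.
apply: (lt_le_trans _ int12).
have : (0 < \int[mu]_(t in `[1%R, 2%R]) (cst (expR (-2))%:E t))%E.
  rewrite integral_cst//= lebesgue_measure_itv/= lte_fin ltr1n -EFinD -EFinM.
  by rewrite lte_fin mulr_gt0 ?expR_gt0//; lra.
move=> /lt_le_trans; apply; apply: ge0_le_integral => //.
- by move=> t _; rewrite lee_fin expR_ge0.
- exact: measurable_funS mg.
- move=> t /=; rewrite in_itv/= => /andP[t1 t2].
  rewrite lee_fin -[leLHS]mul1r ler_pM ?expR_ge0//.
    by rewrite -[leLHS](powRr0 t) ler_powR.
  by rewrite ler_expR; lra.
Qed.

Lemma pochhammerE u n : 1 < u -> pochhammer u n = \prod_(i < n) (u + i%:R).
Proof.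
move=> u1; have u0 := Gamma_gt0 u (ltW u1).
rewrite /pochhammer; elim: n => [|n IH].
  by rewrite big_ord0 addr0 divff// gt_eqF.
rewrite big_ord_recr -IH /= -natr1 addrA GammaS; first by rewrite -mulrA mulrC.
by rewrite (lt_le_trans u1)// lerDl ler0n.
Qed.

Lemma Beta1 b : 1 < b -> Beta 1 b = b^-1.
Proof.
move=> b1; rewrite /Beta Gamma1 mul1r [1 + b]addrC GammaS//.
rewrite invfM mulrCA mulfV ?mulr1//.
by rewrite gt_eqF// Gamma_gt0// ltW.
Qed.

(** Writing J_n(c) for the integral, the factor 1 - e^-t gives
    J_(n+1)(c) = J_n(c) - J_n(c + 1), a recurrence also satisfied by
    n! / (c (c+1) ... (c+n)); J_0 is the exponential integral. *)
Lemma pow_exp_integral n c : 0 < c ->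
  mu.-integrable half
    (EFin \o (fun t => (1 - expR (- t)) ^+ n * expR (- (c * t)))) /\
  \int[mu]_(t in half) ((1 - expR (- t)) ^+ n * expR (- (c * t))) =
    n`!%:R / \prod_(i < n.+1) (c + i%:R).
Proof.
elim: n c => [|n IH] c c0.
  have -> : (fun t : R => (1 - expR (- t)) ^+ 0 * expR (- (c * t))) =
      fun t => expR (- (c * t)) by apply/funext => t; rewrite expr0 mul1r.
  by have [? ->] := exp_integral c c0; rewrite big_ord1 addr0 mul1r.
have c10 : 0 < c + 1 by lra.
have [i1 I1] := IH _ c0; have [i2 I2] := IH _ c10.
have -> : (fun t : R => (1 - expR (- t)) ^+ n.+1 * expR (- (c * t))) =
    fun t => (1 - expR (- t)) ^+ n * expR (- (c * t)) -
      (1 - expR (- t)) ^+ n * expR (- ((c + 1) * t)).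
  apply/funext => t; have -> : - ((c + 1) * t) = - t + - (c * t) by ring.
  by rewrite expRD exprSr; ring.
split; first exact: (integrableB _ i1 i2).
rewrite RintegralB// I1 I2; set P := \prod_(i < n) (c + 1 + i%:R).
have P0 : P != 0.
  by rewrite gt_eqF// prodr_gt0// => i _; rewrite ltr_wpDr.
have PE : \prod_(i < n.+1) (c + i%:R) = c * P.
  rewrite big_ord_recl addr0; congr (_ * _).
  by apply: eq_bigr => i _; rewrite -addrA nat1r.
rewrite [X in _ = _ / X]big_ord_recr PE big_ord_recr -/P/= factS natrM -natr1.
have ? : c + 1 + n%:R != 0 by rewrite gt_eqF// ltr_wpDr.
rewrite [n%:R + 1]addrC [c + (1 + _)]addrA.
field; do ?[apply/andP; split => //]; exact: lt0r_neq0.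
Qed.

End gamma.

(** * Expectations under a discrete law *)

(** A discrete law is the countable sum of the Dirac masses weighted by its
    mass function. *)
Lemma expectation_discrete_prob (R : realType) (p : nat -> R) (X : nat -> R) :
  is_pmf p -> (forall x, 0 <= X x) ->
  ('E_(discrete_prob p)[X] = \sum_(0 <= x <oo) (X x * p x)%:E)%E.
Proof.
move=> pP X0; have [p0 _] := pP; rewrite unlock.
pose m x : {measure set nat -> \bar R} := mscale (NngNum (p0 x)) \d_x.
have EX0 x : [set: nat] x -> (0 <= (X x)%:E)%E by rewrite lee_fin.
rewrite (eq_measure_integral (mseries m 0)) => [|A _ _].
  rewrite ge0_integral_measure_series//.
  apply: eq_eseriesr => x _.
  by rewrite ge0_integral_mscale// integral_dirac// diracT mul1e mulrC.
rewrite /= /discrete_prob asboolT// esum_mkcond -nneseries_esumT; last first.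
  by move=> x; case: ifP; rewrite // lee_fin.
apply: eq_eseriesr => x _; rewrite [RHS]/(((p x)%:E * \d_x A)%E) diracE.
by case: (x \in A); rewrite ?mulr1 ?mulr0.
Qed.

Lemma cvg_eseries_EFin (R : realType) (u : nat -> R) l :
  (fun n => \sum_(0 <= x < n) u x) @ \oo --> l ->
  (\sum_(0 <= x <oo) (u x)%:E = l%:E)%E.
Proof.
move=> ul; apply/cvg_lim => //.
have -> : (fun n => \sum_(0 <= x < n) (u x)%:E)%E =
    EFin \o (fun n => \sum_(0 <= x < n) u x).
  by apply/funext => n /=; rewrite sumEFin.
by apply: (cvg_comp _ _ ul).
Qed.

(** * The mixture as a Yule law, and the Yule moments *)

Section yule.
Context {R : realType}.
Implicit Types (b theta : R) (k n x : nat).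

Lemma gnb_pmf_geometric theta x : 0 <= theta ->
  gnb_pmf 1 1 theta x = (1 - theta) ^+ x * theta.
Proof.
move=> theta0; rewrite /gnb_pmf !mul1r addrK powRr1// nat1r.
suff -> : gbinom (x.+1%:R : R) x = x.+1%:R.
  by rewrite mulVf ?mul1r// pnatr_eq0.
rewrite /gbinom; have -> : \prod_(i < x) (x.+1%:R - i%:R) = (x.+1)`!%:R :> R.
  have /(congr1 (fun n => n%:R : R)) := ffact_fact (leqnSn x).
  rewrite subSnn muln1 => <-; rewrite ffact_prod natr_prod.
  by apply: eq_bigr => i _; rewrite natrB// ltnW// ltnS ltnW.
by rewrite factS natrM mulfK// pnatr_eq0 -lt0n fact_gt0.
Qed.

Lemma be_pdf_exponential b l : 1 < b -> be_pdf 1 b 1 l = b * expR (- (b * l)).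
Proof.
by move=> b1; rewrite /be_pdf Beta1// subrr powRr0 !mulr1 mul1r invrK.
Qed.

Lemma yule_pmfE b x : 1 < b ->
  yule_pmf b x = b * (x`!%:R / \prod_(i < x.+1) (b + 1 + i%:R)).
Proof. by move=> b1; rewrite /yule_pmf pochhammerE ?mulrA//; lra. Qed.

(** Both sides are b times J_x(b + 1), the integral of
    (1 - e^-t)^x e^-((b+1)t). *)
Lemma gnbbe_pmf_yule b : 1 < b -> gnbbe_pmf 1 1 1 b 1 = yule_pmf b.
Proof.
move=> b1; apply/funext => x; rewrite yule_pmfE//.
have b10 : 0 < b + 1 by lra.
have [ix <-] := pow_exp_integral x (b + 1) b10.
rewrite -RintegralZl//; apply: eq_Rintegral => l _.
rewrite gnb_pmf_geometric ?expR_ge0// be_pdf_exponential//.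
have -> : - ((b + 1) * l) = - l + - (b * l) by ring.
by rewrite expRD; ring.
Qed.

(** This is P(X >= n) for X of Yule law with parameter b. *)
Definition yule_tail b n : R := n`!%:R / \prod_(i < n) (b + 1 + i%:R).

Lemma yule_tail0 b : yule_tail b 0 = 1.
Proof. by rewrite /yule_tail big_ord0 divr1. Qed.

Lemma yule_tailS b n :
  yule_tail b n.+1 = yule_tail b n * (n.+1%:R / (b + n.+1%:R)).
Proof.
rewrite /yule_tail big_ord_recr factS natrM/= -addrA nat1r invfM; ring.
Qed.

Lemma yule_tail_ge0 b n : 0 < b -> 0 <= yule_tail b n.
Proof.
move=> b0; rewrite /yule_tail divr_ge0// prodr_ge0// => i _.
by rewrite -addrA nat1r addr_ge0// ltW.
Qed.

Lemma yule_pmf_tail b n : 1 < b ->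
  yule_pmf b n = yule_tail b n * (b / (b + n.+1%:R)).
Proof.
move=> b1; rewrite yule_pmfE// /yule_tail big_ord_recr/= -addrA nat1r invfM.
ring.
Qed.

Definition yule_partial_moment b k n : R :=
  \sum_(0 <= x < n) (x ^_ k)%:R * yule_pmf b x.

Lemma yule_partial_moment0 b n : 1 < b ->
  yule_partial_moment b 0 n = 1 - yule_tail b n.
Proof.
move=> b1; rewrite /yule_partial_moment; elim: n => [|n IH].
  by rewrite big_nil yule_tail0 subrr.
rewrite big_nat_recr//= IH ffactn0 mul1r yule_pmf_tail// yule_tailS.
have : b + n.+1%:R != 0 by rewrite gt_eqF// ltr_wpDr//; lra.
by move: n.+1%:R => d d0; field.
Qed.

(** This is summation by parts for p_x = T_x - T_(x+1) and
    x^_(k+1) - (x-1)^_(k+1) = (k+1) (x-1)^_k, followed by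
    T_(x+1) = (x+1) p_x / b and (x+1) x^_k = x^_(k+1) + (k+1) x^_k; the term in x^_(k+1) goes to the
    left-hand side. The induction on n checks the increments. *)
Lemma yule_partial_momentS b k n : 1 < b ->
  (b - k.+1%:R) * yule_partial_moment b k.+1 n =
  k.+1%:R ^+ 2 * yule_partial_moment b k n -
    b * ((n ^_ k.+1)%:R * yule_tail b n).
Proof.
move=> b1; rewrite /yule_partial_moment; elim: n => [|n IH].
  by rewrite !big_nil ffact0n mul0r !mulr0 subr0.
rewrite !big_nat_recr//= !mulrDr IH yule_pmf_tail// yule_tailS ffactSS.
have ? : b + n.+1%:R != 0 by rewrite gt_eqF// ltr_wpDr//; lra.
have nk : (n ^_ k.+1)%:R = (n ^_ k)%:R * (n%:R - k%:R) :> R.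
  (* Truncated subtraction is harmless: n ^_ k is 0 when n < k. *)
  rewrite ffactnSr natrM; have [kn|nk] := leqP k n; first by rewrite natrB.
  by rewrite ffact_small// !mul0r.
rewrite natrM nk; field.
by rewrite ?nat1r ?natr1.
Qed.

Lemma ffact_mul_fact_le n k : (n ^_ k * n`! <= (n + k)`!)%N.
Proof.
have := ffact_fact (leq_addl n k); rewrite addnK => <-.
rewrite leq_mul2r !ffact_prod leq_prod ?orbT// => i _.
by rewrite leq_sub2r// leq_addr.
Qed.

Lemma series_harmonic_ge0 n : 0 <= series (@harmonic R) n.
Proof. by apply: sumr_ge0 => i _; exact: harmonic_ge0. Qed.

(** For b = k the ratio (n+k)! T_n / (n! k!) is 1. In general, with
    e = b - k, it is the product of the factors (1 + e / (k+j))^-1 for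
    1 <= j <= n, and the product of the 1 + e / (k+j) is at least
    1 + sum_j e / (k+j), where k + j <= (k+1) j. *)
Lemma yule_tail_harmonic_bound b k n : k%:R < b ->
  (1 + (b - k%:R) / k.+1%:R * series harmonic n) *
    ((n + k)`!%:R * yule_tail b n) <= n`!%:R * k`!%:R.
Proof.
move=> kb; have b0 : 0 < b by apply: le_lt_trans kb; exact: ler0n.
set c := (b - k%:R) / k.+1%:R.
have c0 : 0 <= c by rewrite divr_ge0// subr_ge0 ltW.
elim: n => [|n IH].
  by rewrite /series/= big_nil mulr0 addr0 yule_tail0 !mul1r mulr1.
rewrite /series/= big_nat_recr//= -/(series harmonic n).
set g := 1 + c * series harmonic n in IH.
have g1 : 1 <= g.
  by rewrite /g lerDl mulr_ge0// series_harmonic_ge0.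
have -> : 1 + c * (series harmonic n + n.+1%:R^-1) = g + c / n.+1%:R.
  by rewrite /g mulrDr addrA.
set K : R := (n + k).+1%:R; set D := b + n.+1%:R.
have D0 : 0 < D by rewrite /D addr_gt0.
have gK : (g + c / n.+1%:R) * K <= g * D.
  have Kn : K <= k.+1%:R * n.+1%:R by rewrite /K -natrM ler_nat; lia.
  have cK : c / n.+1%:R * K <= b - k%:R.
    rewrite mulrAC ler_pdivrMr// /c mulrAC ler_pdivrMr// -mulrA.
    by rewrite ler_wpM2l ?subr_ge0 ?(ltW kb)// mulrC.
  rewrite mulrDl; have -> : D = K + (b - k%:R).
    by rewrite /D /K -addnS addnC natrD; ring.
  rewrite mulrDr lerD2l (le_trans cK)// ler_peMl// subr_ge0 ltW//.
rewrite addSn factS natrM -/K yule_tailS factS natrM -/D.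
apply: (@le_trans _ _ (n.+1%:R * (g * ((n + k)`!%:R * yule_tail b n))));
  last first.
  by rewrite -mulrA ler_pM2l.
set Q := (n + k)`!%:R; set T := yule_tail b n.
have QT : 0 <= n.+1%:R / D * (Q * T).
  by rewrite mulr_ge0 ?divr_ge0 ?(ltW D0)// mulr_ge0 ?yule_tail_ge0.
rewrite [leLHS](_ : _ = (g + c / n.+1%:R) * K * (n.+1%:R / D * (Q * T)));
  last by ring.
rewrite [leRHS](_ : _ = g * D * (n.+1%:R / D * (Q * T)));
  first exact: ler_wpM2r.
by move: (n.+1%:R : R) => d; field; exact: lt0r_neq0.
Qed.

(** The exponent of decay b - k of this sequence may be arbitrarily small;
    the divergence of the harmonic series settles all cases at once. *)
Lemma cvg_ffact_yule_tail b k : k%:R < b ->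
  (n ^_ k)%:R * yule_tail b n @[n --> \oo] --> 0.
Proof.
move=> kb; have b0 : 0 < b by apply: le_lt_trans kb; exact: ler0n.
set c := (b - k%:R) / k.+1%:R.
have c0 : 0 < c by rewrite divr_gt0// subr_gt0.
pose g n := 1 + c * series harmonic n.
have g1 n : 1 <= g n.
  by rewrite /g lerDl mulr_ge0 ?series_harmonic_ge0// ltW.
have Hy : series (@harmonic R) n @[n --> \oo] --> +oo.
  apply: nondecreasing_dvgn_lt; last exact: dvg_harmonic.
  by apply: nondecreasing_series => i _ _; exact: harmonic_ge0.
have gy : g n @[n --> \oo] --> +oo.
  apply/cvgryPge => A; move/cvgryPge/(_ (A / c)) : Hy; apply: filterS => n.
  rewrite ler_pdivrMr// mulrC => /le_trans; apply; rewrite /g lerDr//.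
have gV : (g n)^-1 @[n --> \oo] --> 0.
  apply/gtr0_cvgV0 => //; apply: nearW => n; exact: lt_le_trans (g1 n).
apply: (@squeeze_cvgr _ _ _ _ (cst 0) (fun n => k`!%:R * (g n)^-1)).
- apply: nearW => n; rewrite mulr_ge0 ?yule_tail_ge0//=.
  have g0 : 0 < g n by exact: lt_le_trans (g1 n).
  rewrite ler_pdivlMr//.
  have nf : 0 < n`!%:R :> R by rewrite ltr0n fact_gt0.
  rewrite -(ler_pM2l nf).
  have := yule_tail_harmonic_bound b k n kb; rewrite -/c -/(g n).
  have := yule_tail_ge0 b n b0; move: (yule_tail b n) => T T0 /(le_trans _).
  apply; rewrite [leRHS]mulrC !mulrA ler_wpM2r ?(ltW g0)//.
  by rewrite ler_wpM2r// -natrM ler_nat mulnC ffact_mul_fact_le.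
- exact: cvg_cst.
- by rewrite -(mulr0 k`!%:R); apply: cvgMl_tmp.
Qed.

Lemma cvg_yule_partial_moment b k : 1 < b -> k%:R < b ->
  yule_partial_moment b k n @[n --> \oo] -->
    k`!%:R ^+ 2 / \prod_(1 <= i < k.+1) (b - i%:R).
Proof.
move=> b1; elim: k => [|k IH] kb.
  rewrite big_nil divr1 expr1n
    (_ : yule_partial_moment b 0 = fun n => 1 - yule_tail b n).
    rewrite -[X in _ --> X]subr0; apply: cvgB; first exact: cvg_cst.
    have := cvg_ffact_yule_tail b 0 kb.
    by under eq_fun do rewrite ffactn0 mul1r.
  by apply/funext => n; rewrite yule_partial_moment0.
have kb' : k%:R < b by apply: lt_trans kb; rewrite ltr_nat.
have bk : b - k.+1%:R != 0 by rewrite gt_eqF// subr_gt0.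
rewrite (_ : yule_partial_moment b k.+1 = fun n => (b - k.+1%:R)^-1 *
  (k.+1%:R ^+ 2 * yule_partial_moment b k n -
    b * ((n ^_ k.+1)%:R * yule_tail b n))); last first.
  by apply/funext => n; rewrite -yule_partial_momentS// mulKf.
rewrite [X in _ --> X](_ : _ = (b - k.+1%:R)^-1 *
  (k.+1%:R ^+ 2 * (k`!%:R ^+ 2 / \prod_(1 <= i < k.+1) (b - i%:R)) - b * 0)).
  apply: cvgMl_tmp; apply: cvgB; apply: cvgMl_tmp; first exact: IH.
  exact: cvg_ffact_yule_tail.
rewrite mulr0 subr0 [in LHS]big_nat_recr//= factS natrM invfM; ring.
Qed.

Lemma is_pmf_yule b : 1 < b -> is_pmf (yule_pmf b).
Proof.
move=> b1; split=> [x|].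
  have b0 : 0 < b by lra.
  by rewrite yule_pmf_tail// mulr_ge0 ?yule_tail_ge0// divr_ge0 ?addr_ge0// ltW.
apply: cvg_eseries_EFin; have b0 : 0%:R < b by rewrite (lt_trans ltr01).
have := cvg_yule_partial_moment b 0 b1 b0.
rewrite big_nil divr1 expr1n /yule_partial_moment.
by under eq_fun do under eq_bigr do rewrite ffactn0 mul1r.
Qed.

Lemma factorial_moment_yule b k : 1 < b -> k%:R < b ->
  factorial_moment (Yule b) k =
    ((k`!%:R ^+ 2) / (\prod_(1 <= i < k.+1) (b - i%:R)))%:E.
Proof.
move=> b1 kb; rewrite /factorial_moment expectation_discrete_prob//.
  exact/cvg_eseries_EFin/cvg_yule_partial_moment.
exact: is_pmf_yule.
Qed.
End yule.

Theorem corollary4 (R : realType) (b : R) (k : nat)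
    (b_gt0 : 0 < b) (k_ge1 : (1 <= k)%N) (b_gtk : k%:R < b) :
  factorial_moment (GNB_BE 1 1 1 b 1) k = factorial_moment (Yule b) k /\
  factorial_moment (Yule b) k =
    ((k`!%:R ^+ 2) / (\prod_(1 <= i < k.+1) (b - i%:R)))%:E.
Proof.
have b1 : 1 < b by apply: le_lt_trans b_gtk; rewrite ler1n.
split; last exact: factorial_moment_yule.
by rewrite /GNB_BE gnbbe_pmf_yule.
Qed.
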